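(* Let $m\in\{0,1,2,\dots\}$, let $q\in\mathbb{C}$ with $0<|q|<1$, and let $a\in\mathbb{C}\setminus\{0\}$. Then as $n\to\infty$, $$H_n[q^{-m}a;a|q^{-1}]\sim q^{-2\binom m2}\left(\frac{a^2}{q}\right)^m a^{-n}.$$
   Context: Here $f_n\sim g_n$ means $f_n/g_n\to1$ as $n\to\infty$. Notation: $(A;p)_n=\prod_{j=0}^{n-1}(1-Ap^j)$ for $p\in\mathbb{C}\setminus\{0\}$; $(A,B,C;p)_k=(A;p)_k(B;p)_k(C;p)_k$; $\binom m2=\frac{m(m-1)}2$. Continuous big Hermite polynomials: for a base $p\in\mathbb{C}\setminus\{0\}$, $|p|\ne1$, $a,z\in\mathbb{C}\setminus\{0\}$, $x=\frac12(z+z^{-1})$, $$H_n[z;a|p]=H_n(x;a|p)=a^{-n}\sum_{k=0}^n\frac{(p^{-n},az,az^{-1};p)_k}{(p;p)_k}\,p^k .$$ The continuous big $q^{-1}$-Hermite polynomials are $H_n[z;a|q^{-1}]$, i.e. $p=q^{-1}$. *)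

(* Defs.v *)
From mathcomp Require Import all_boot all_order all_algebra.
From mathcomp Require Import all_classical all_reals all_analysis.
From mathcomp Require Import complex.

Set Implicit Arguments.
Unset Strict Implicit.
Unset Printing Implicit Defensive.

Import Order.TTheory GRing.Theory Num.Theory.
Import numFieldNormedType.Exports.

Local Open Scope classical_set_scope.
Local Open Scope ring_scope.

Definition qpoch (C : fieldType) (A p : C) (n : nat) : C :=
  \prod_(j < n) (1 - A * p ^+ j).

Definition qpoch3 (C : fieldType) (A1 A2 A3 p : C) (k : nat) : C :=
  qpoch A1 p k * qpoch A2 p k * qpoch A3 p k.

(* The value [H_n[z;a|p]], i.e. the continuous big Hermite polynomial at
   x = (z + z^-1) / 2; meaningful for a, z, p != 0 and `|p| != 1. *)
Definition big_hermite (C : fieldType) (n : nat) (z a p : C) : C :=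
  a ^- n * \sum_(k < n.+1)
    qpoch3 (p ^- n) (a * z) (a * z^-1) p k / qpoch p p k * p ^+ k.

(* Since division by 0 yields 0, this forces g to be eventually nonzero. *)
Definition asymp_equiv (C : numFieldType) (f g : nat -> C) : Prop :=
  (fun n => f n / g n) @ \oo --> (1 : C).

(* Main.v *)
Require Import Defs.
From mathcomp Require Import all_boot all_order all_algebra.
From mathcomp Require Import all_classical all_reals all_analysis.
From mathcomp Require Import complex ring.

Import Order.TTheory GRing.Theory Num.Theory.
Import numFieldNormedType.Exports.

Local Open Scope ring_scope.

(** Write p = q^-1.  At z = q^-m a the two parameters of the sum are
    az = a^2 p^m and a/z = p^-m, and the factor (p^-m; p)_k vanishes for k > m.
    So for n >= m the sum has m + 1 terms, whatever n is, and n enters only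
    through (p^-n; p)_k = (q^n; p)_k, which tends to 1 because q^n tends to 0
    ([qpoch_cvg1]).  Hence a^n H_n converges to

      sum_(k <= m) (p^-m, a^2 p^m; p)_k / (p; p)_k p^k,

    which the q-Chu-Vandermonde formula with lower parameter 0
    ([chu_vandermonde0]) evaluates to (a^2 p^m)^m.  This is nonzero and, since
    m^2 = 2 binom(m, 2) + m, equal to q^(-2 binom(m, 2)) (a^2 / q)^m. *)

Lemma qpoch0 {C : fieldType} (A p : C) : qpoch A p 0 = 1.
Proof. by rewrite /qpoch big_ord0. Qed.

Lemma qpochSr {C : fieldType} (A p : C) k :
  qpoch A p k.+1 = qpoch A p k * (1 - A * p ^+ k).
Proof. by rewrite /qpoch big_ord_recr. Qed.

Lemma qpochSl {C : fieldType} (A p : C) k :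
  qpoch A p k.+1 = (1 - A) * qpoch (A * p) p k.
Proof.
rewrite /qpoch big_ord_recl expr0 mulr1; congr (_ * _).
by apply: eq_bigr => i _; rewrite lift0 exprS mulrA.
Qed.

Lemma qpoch_exprV_eq0 {C : fieldType} {p : C} {m k} :
  p != 0 -> (m < k)%N -> qpoch (p ^- m) p k = 0.
Proof.
move=> p0 mk; rewrite /qpoch (bigD1 (Ordinal mk)) //=.
by rewrite mulVf ?expf_neq0// subrr mul0r.
Qed.

Lemma qpoch_self_neq0 {C : fieldType} {p : C} k :
  (forall j, p ^+ j.+1 != 1) -> qpoch p p k != 0.
Proof.
move=> p1; apply/prodf_neq0 => j _.
by rewrite -exprS subr_eq0 eq_sym.
Qed.

Definition vandermonde_coef {C : fieldType} (p : C) (m k : nat) : C :=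
  qpoch (p ^- m) p k / qpoch p p k * p ^+ k.

(** Up to sign and a power of p this coefficient is a Gaussian binomial, and
    the recurrence is its Pascal rule; it drives the induction in
    [chu_vandermonde0]. *)
Lemma vandermonde_coef_pascal {C : fieldType} {p : C} {m k} :
    p != 0 -> (forall j, p ^+ j.+1 != 1) ->
  vandermonde_coef p m.+1 k.+1 =
  vandermonde_coef p m k.+1 - p ^- m * vandermonde_coef p m k.
Proof.
move=> p0 p1; rewrite /vandermonde_coef.
rewrite qpochSl (qpochSr (p ^- m)) (qpochSr p).
have -> : p ^- m.+1 * p = p ^- m by rewrite exprSr invfM -mulrA mulVf ?mulr1.
have Y0 := qpoch_self_neq0 k p1.
have Z0 : 1 - p * p ^+ k != 0 by rewrite -exprS subr_eq0 eq_sym.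
have P0 : p ^+ m != 0 by rewrite expf_neq0.
by rewrite !exprS; field; rewrite p0 P0 Y0 Z0.
Qed.

(** Induction on m for all B at once: the Pascal rule and
    (B; p)_(k+1) = (1 - B) (Bp; p)_k express the sum for m + 1 at B as the sum
    for m at B minus p^-m (1 - B) times the sum for m at Bp, that is
    B^m - (1 - B) B^m = B^(m+1).  The terms with m < k < N vanish; leaving N
    free lets the shifted sum fall under the induction hypothesis. *)
Lemma chu_vandermonde0 {C : fieldType} {p : C} :
    p != 0 -> (forall j, p ^+ j.+1 != 1) ->
  forall m N B, (m < N)%N ->
  \sum_(k < N) vandermonde_coef p m k * qpoch B p k = B ^+ m.
Proof.
move=> p0 p1; elim=> [|m IHm] [//|N] B mN.
  rewrite big_ord_recl big1 => [|i _].
    by rewrite /vandermonde_coef !qpoch0 invr1 !expr0 !mulr1 addr0.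
  by rewrite /vandermonde_coef qpoch_exprV_eq0// !mul0r.
have -> : B ^+ m.+1 = B ^+ m - p ^- m * (1 - B) * (B * p) ^+ m.
  have P0 : p ^+ m != 0 by rewrite expf_neq0.
  by rewrite exprMn exprS; field.
rewrite -(IHm N.+1 B (ltnW mN)) -(IHm N (B * p) mN).
rewrite !big_ord_recl mulr_sumr -addrA -sumrB; congr (_ + _).
  by rewrite /vandermonde_coef !qpoch0 expr0.
apply: eq_bigr => i _.
by rewrite lift0 vandermonde_coef_pascal// qpochSl; ring.
Qed.

(** The modulus of a complex number is the image of a real number, so the limit
    reduces to that of a real geometric sequence. *)
Lemma cvg_exprC {R : realType} {q : R[i]} :
  `|q| < 1 -> (q ^+ n @[n --> \oo] --> (0 : (R[i] : numFieldType)))%classic.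
Proof.
(* The topology on R[i] is the one it has as a numeric field, hence K. *)
move=> q1; pose K : numFieldType := R[i].
apply/(@cvgr0Pnorm_lt K K) => /= e e0.
have er : (complex.Re e)%:C%C = e by rewrite RRe_real// gtr0_real.
have qr : (complex.Re `|q|)%:C%C = `|q| by rewrite RRe_real// normr_real.
have r1 : `|complex.Re `|q| | < 1.
  have r0 : 0 <= complex.Re `|q| by rewrite -lecR qr; exact: normr_ge0.
  by rewrite ger0_norm// -ltcR qr.
have re0 : 0 < complex.Re e by rewrite -ltcR er.
have /cvgr0Pnorm_lt/(_ _ re0) := cvg_expr r1.
apply: filterS => n.
have -> : `|q ^+ n| = (complex.Re `|q| ^+ n)%:C%C.
  by rewrite normrX -{1}qr (rmorphXn (real_complex R)).
rewrite -er ltcR.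
by apply: le_lt_trans; rewrite ler_norm.
Qed.

Lemma qpoch_cvg1 {K : numFieldType} {u : nat -> K} (p : K) k :
  (u n @[n --> \oo] --> (0 : K) ->
   qpoch (u n) p k @[n --> \oo] --> (1 : K))%classic.
Proof.
move=> u0; elim: k => [|k IHk].
  by under eq_cvg do rewrite qpoch0; exact: cvg_cst.
under eq_cvg do rewrite qpochSr.
have lin : (1 - u n * p ^+ k @[n --> \oo] --> 1 - 0 * p ^+ k)%classic.
  by apply: cvgB; [exact: cvg_cst | exact: cvgMr_tmp].
have := cvgM IHk lin; rewrite mul0r subr0 mulr1; exact.
Qed.

(** Over R[i] the convergence hypothesis follows from the bound on the modulus;
    over a general numeric field, possibly non-Archimedean, it does not.  The
    bound itself ensures that 1/q is not a root of unity, so that no (p; p)_k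
    vanishes. *)
Lemma big_hermite_asymp {K : numFieldType} (m : nat) (q a : K) :
    q != 0 -> a != 0 -> `|q| < 1 -> (q ^+ n @[n --> \oo] --> (0 : K))%classic ->
  asymp_equiv
    (fun n => big_hermite n (q ^- m * a) a q^-1)
    (fun n => q ^- (2 * 'C(m, 2)) * (a ^+ 2 / q) ^+ m * a ^- n).
Proof.
move=> q0 a_neq0 q_lt1 qn0.
set p := q^-1; have p0 : p != 0 by rewrite invr_eq0.
have p1 j : p ^+ j.+1 != 1.
  rewrite exprVn invr_eq1; apply/eqP => qj.
  have := @exprn_ilt1 _ j.+1 _ (normr_ge0 q) q_lt1.
  by rewrite -normrX qj normr1 ltxx.
pose B := a ^+ 2 * p ^+ m.
have B0 : B ^+ m != 0 by rewrite expf_neq0// mulf_neq0// expf_neq0.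
have limE : q ^- (2 * 'C(m, 2)) * (a ^+ 2 / q) ^+ m = B ^+ m.
  have mm : (m * m = 2 * 'C(m, 2) + m)%N.
    rewrite mul_bin_left bin1; case: (m) => // k.
    by rewrite subn1 mulnS addnC mulnC.
  by rewrite /B !exprMn -exprM mm exprD !exprVn; ring.
have azE : a * (q ^- m * a) = B by rewrite /B exprVn; ring.
have aVzE : a * (q ^- m * a)^-1 = p ^- m.
  by rewrite /p exprVn invfM !invrK mulrCA divff// mulr1.
rewrite /asymp_equiv limE.
(* S n is the sum in a^n H_n cut at k = m: as many terms for every n. *)
pose S n := \sum_(k < m.+1)
  qpoch (q ^+ n) p k * (vandermonde_coef p m k * qpoch B p k).
have hermite_ratio n : (m <= n)%N ->
    big_hermite n (q ^- m * a) a p / (B ^+ m * a ^- n) = S n / B ^+ m.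
  move=> mn; rewrite /big_hermite azE aVzE.
  have -> :
    \sum_(k < n.+1) qpoch3 (p ^- n) B (p ^- m) p k / qpoch p p k * p ^+ k
    = S n.
    rewrite /S (big_ord_widen n.+1 (fun k => qpoch (q ^+ n) p k *
      (vandermonde_coef p m k * qpoch B p k)))//.
    rewrite [RHS]big_mkcond /=.
    apply: eq_bigr => k _; rewrite /qpoch3 /vandermonde_coef.
    have -> : p ^- n = q ^+ n by rewrite exprVn invrK.
    case: ltnP => mk; first by ring.
    by rewrite (qpoch_exprV_eq0 p0 mk) mulr0 !mul0r.
  have an : a ^+ n != 0 by rewrite expf_neq0.
  by field; rewrite B0 an.
have S_cvg : (S n @[n --> \oo] --> B ^+ m)%classic.
  rewrite -(chu_vandermonde0 p0 p1 m m.+1 B (ltnSn m)).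
  apply: cvg_big => [|k _]; first exact: add_continuous.
  pose c := vandermonde_coef p m k * qpoch B p k.
  have := cvgMr_tmp (b := c) (qpoch_cvg1 p k qn0); rewrite mul1r; exact.
have : (S n / B ^+ m @[n --> \oo] --> (1 : K))%classic.
  by rewrite -(divff B0); apply: cvgMr_tmp.
apply: cvg_trans; apply: near_eq_cvg.
by exists m => // n /= mn; rewrite hermite_ratio.
Qed.

Theorem lemma4p27 (R : realType) (m : nat) (q a : R[i])
    (q_gt0 : 0 < `|q|) (q_lt1 : `|q| < 1) (a_neq0 : a != 0) :
  asymp_equiv
    (fun n => big_hermite n (q ^- m * a) a q^-1)
    (fun n => q ^- (2 * 'C(m, 2)) * (a ^+ 2 / q) ^+ m * a ^- n).
Proof.
apply: big_hermite_asymp => //; first by rewrite -normr_gt0.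
exact: cvg_exprC.
Qed.
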